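(* \textsc{Multipacking} (finding the maximum size of a multipacking) can be solved in linear time on single-sourced layered DAGs.
   Context: Digraphs are finite and assumed weakly connected. For vertices $u,v$, $d(u,v)$ is the length of a shortest directed path from $u$ to $v$ ($\infty$ if none); $B^+_r(v)=\{u: d(v,u)\le r\}$. A multipacking of $D$ is a set $S\subseteq V(D)$ such that for every vertex $v$ and every integer $r\ge 1$, $|B^+_r(v)\cap S|\le r$. \textsc{Multipacking}: given $D$ and $k$, decide whether $D$ has a multipacking of size at least $k$. A DAG $D$ is layered if $V(D)$ can be partitioned into $V_0,\dots,V_t$ such that vertices of $V_0$ have no in-neighbors, vertices of $V_t$ have no out-neighbors, and every arc goes from some $V_i$ to $V_{i+1}$. A single-sourced layered DAG is a layered DAG with only one source, i.e. $|V_0|=1$. *)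

(* Defs.v *)
From mathcomp Require Import all_boot.
Set Implicit Arguments.
Unset Strict Implicit.
Unset Printing Implicit Defensive.

(** * Digraphs, distances, multipackings *)

(* Simple digraphs; the vertex set is identified with {0, ..., dg_order - 1}. *)
Record digraph := Digraph { dg_order : nat; dg_arc : rel 'I_dg_order }.

Section Digraphs.
Variables (T : finType) (e : rel T).

Definition weakly_connected : Prop :=
  forall u v : T, connect (fun x y => e x y || e y x) u v.

Definition acyclic : Prop := forall c : seq T, cycle e c -> c = [::].

Definition sources : {set T} := [set v | [forall u, ~~ e u v]].

Definition walk (u v : T) (k : nat) : bool :=
  [exists p : k.-tuple T, path e u p && (last u p == v)].

Lemma connect_walkP u v : reflect (exists k, walk u v k) (connect e u v).
Proof.
apply: (iffP connectP) => [[p ep ->]|[k /existsP[p /andP[ep /eqP <-]]]].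
  by exists (size p); apply/existsP; exists (in_tuple p); rewrite /= ep eqxx.
by exists p.
Qed.

(* [None] stands for an infinite distance.  A shortest walk is a path, so
   minimising over walks gives the length of a shortest directed path. *)
Definition dist (u v : T) : option nat :=
  if connect_walkP u v is ReflectT uv then Some (ex_minn uv) else None.

Definition out_ball (r : nat) (v : T) : {set T} :=
  [set u | if dist v u is Some k then k <= r else false].

Definition multipacking (S : {set T}) : Prop :=
  forall (v : T) (r : nat), 1 <= r -> #|out_ball r v :&: S| <= r.

Definition layering (t : nat) (V : 'I_t.+1 -> {set T}) : Prop :=
  [/\ [/\ forall i, V i != set0,
          forall i j, i != j -> [disjoint V i & V j]
        & \bigcup_i V i = [set: T]],
      forall u v, v \in V ord0 -> ~~ e u v,
      forall u v, u \in V ord_max -> ~~ e u v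
    & forall u v, e u v ->
        exists i j : 'I_t.+1, [/\ u \in V i, v \in V j & j = i.+1 :> nat]].

Definition single_sourced_layered_dag : Prop :=
  [/\ weakly_connected, acyclic,
      exists t (V : 'I_t.+1 -> {set T}), layering V
    & #|sources| = 1].

(* In any layering, having only one source means that the first layer is
   exactly that source. *)
Lemma single_source_layer0 t (V : 'I_t.+1 -> {set T}) :
  layering V -> #|sources| = 1 -> V ord0 = sources /\ #|V ord0| = 1.
Proof.
case=> -[V0 _ _] src0 _ _ s1; suff E : V ord0 = sources by rewrite E.
apply/eqP; rewrite eqEcard s1 card_gt0 V0 andbT.
by apply/subsetP=> v v0; rewrite inE; apply/forallP=> u; apply: src0.
Qed.

Definition max_multipacking_size (s : nat) : Prop :=
  (exists S : {set T}, multipacking S /\ #|S| = s) /\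
  (forall S : {set T}, multipacking S -> #|S| <= s).

(* Answer bit: 1 for yes, 0 for no. *)
Definition multipacking_decision (k b : nat) : Prop :=
  (b = 1 /\ exists S : {set T}, multipacking S /\ k <= #|S|) \/
  (b = 0 /\ ~ exists S : {set T}, multipacking S /\ k <= #|S|).

End Digraphs.

(** * Random access machines

    Unit-cost RAM over natural numbers with registers and an indirectly
    addressed memory; the only arithmetic is addition and truncated
    subtraction.  A program is a list of instructions, jumps are absolute, and
    the machine halts when the program counter leaves the program. *)

Inductive instr :=
  | Const (r k : nat)   (* r <- k *)
  | Copy (r s : nat)    (* r <- s *)
  | Add (r s t : nat)   (* r <- s + t *)
  | Sub (r s t : nat)   (* r <- s - t, truncated at 0 *)
  | Read (r s : nat)    (* r <- mem[s] *)
  | Write (r s : nat)   (* mem[r] <- s *)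
  | Jump (l : nat)
  | Jzero (r l : nat).  (* jump to l if r = 0 *)

Definition program := seq instr.

Record config := Config { pc : nat; reg : nat -> nat; memory : nat -> nat }.

Definition upd (f : nat -> nat) (a w : nat) : nat -> nat :=
  fun b => if b == a then w else f b.

Definition exec (i : instr) (c : config) : config :=
  let: Config pc R M := c in
  match i with
  | Const r k => Config pc.+1 (upd R r k) M
  | Copy r s => Config pc.+1 (upd R r (R s)) M
  | Add r s t => Config pc.+1 (upd R r (R s + R t)) M
  | Sub r s t => Config pc.+1 (upd R r (R s - R t)) M
  | Read r s => Config pc.+1 (upd R r (M (R s))) M
  | Write r s => Config pc.+1 R (upd M (R r) (R s))
  | Jump l => Config l R M
  | Jzero r l => Config (if R r == 0 then l else pc.+1) R M
  end.

Definition halted (p : program) (c : config) : bool := size p <= pc c.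

(* Halted configurations are fixed points. *)
Definition step (p : program) (c : config) : config :=
  if onth p (pc c) is Some i then exec i c else c.

(* The input occupies the memory cells from address 0 on, and register 0 holds
   its length; everything else is 0. *)
Definition init (x : seq nat) : config :=
  Config 0 (upd (fun=> 0) 0 (size x)) (fun a => nth 0 x a).

Definition run (p : program) (x : seq nat) (k : nat) : config :=
  iter k (step p) (init x).

(* On input x, p halts after at most t steps with y in register 0, and never
   holds a value larger than w in a register or a memory cell. *)
Definition computes (p : program) (x : seq nat) (y t w : nat) : Prop :=
  [/\ halted p (run p x t), reg (run p x t) 0 = y
    & forall k a, reg (run p x k) a <= w /\ memory (run p x k) a <= w].

(* Linear time in the number of words of the input.  As in the word RAM model,
   words have logarithmically many bits: values stay within a constant factor
   of the input length plus the largest input word.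
   [C] is the class of instances the problem is restricted to (no behaviour is
   required outside it), [enc i x] says that x is a valid encoding of i, and
   [ans i y] that y is a correct answer. *)
Definition solvable_in_linear_time (I : Type) (C : I -> Prop)
    (enc : I -> seq nat -> Prop) (ans : I -> nat -> Prop) : Prop :=
  exists (p : program) (c : nat), forall (i : I) (x : seq nat),
    C i -> enc i x ->
    exists y, ans i y /\
      computes p x y (c * size x) (c * (size x + \max_(w <- x) w)).

(** * Adjacency-list encoding *)

(* The number of vertices, then for each vertex in turn its out-degree followed
   by its out-neighbours. *)
Definition adjacency_words (n : nat) (adj : 'I_n -> seq 'I_n) : seq nat :=
  n :: flatten [seq size (adj u) :: map val (adj u) | u <- enum 'I_n].

(* The out-neighbours of a vertex may be listed in any order. *)
Definition encodes (D : digraph) (x : seq nat) : Prop :=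
  exists adj : 'I_(dg_order D) -> seq 'I_(dg_order D),
    [/\ forall u, uniq (adj u), forall u v, (v \in adj u) = dg_arc u v
      & x = adjacency_words adj].

Definition encodes_with_bound (Dk : digraph * nat) (x : seq nat) : Prop :=
  exists2 x', encodes Dk.1 x' & x = rcons x' Dk.2.

(* The encoding has 1 + |V| + |A| words. *)
Lemma size_encodes (D : digraph) (x : seq nat) : encodes D x ->
  size x = 1 + dg_order D +
    #|[set a : 'I_(dg_order D) * 'I_(dg_order D) | dg_arc a.1 a.2]|.
Proof.
case=> adj [uadj adjE ->] /=; rewrite -addnA add1n; congr _.+1.
rewrite size_flatten /shape -map_comp sumnE big_map big_enum /=.
under eq_bigr => u _ do rewrite size_map -addn1 addnC.
rewrite big_split /= sum1_card card_ord; congr (_ + _).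
rewrite -sum1_card.
rewrite (eq_bigl (fun a => true && (dg_arc a.1 a.2))); last by move=> a; rewrite inE.
rewrite -(pair_big_dep xpredT (fun u v => dg_arc u v) (fun _ _ => 1)) /=.
apply: eq_bigr => u _; rewrite sum1_card -(card_uniqP (uadj u)).
by apply: eq_card => v; rewrite adjE.
Qed.

(* Main.v *)
Require Import Defs.
From mathcomp Require Import all_boot.
From mathcomp Require Import zify.
Set Implicit Arguments.
Unset Strict Implicit.
Unset Printing Implicit Defensive.

(* Let V_0 = {s}, ..., V_t be the layers.  Put A_0 = V_0, and let A_(i+1) be
   V_(i+1) if A_i is empty, and otherwise the set of the vertices of V_(i+1) that
   are not out-neighbours of all of A_i.  The maximum size of a multipacking is
   the number of indices i with A_i nonempty.

   Lower bound: following non-adjacent pairs backwards through the A_i gives an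
   independent set with one vertex on each level where A_i is nonempty, and an
   independent set with at most one vertex per level is a multipacking, since a
   ball of radius r meets r + 1 levels.

   Upper bound: by strong induction on i, a multipacking S has at most as many
   vertices on the levels 0, ..., i as there are nonempty sets among A_0, ..., A_i.
   Let j <= i be the last index with A_j empty.  Any a in A_(j-1) dominates V_j,
   hence its ball of radius i - j + 1 contains the levels j, ..., i, and S has at
   most i - j + 1 vertices there, a itself counted.  This is one too many only if
   S avoids A_(j-1) and attains the bound below level j, and balls of radius 1 show
   that it cannot do both.

   The A_i are computed layer by layer in a breadth-first search, where each vertex
   counts its in-neighbours in the previous A_i. *)

(** * The maximum size of a multipacking *)

Section Walks.
Variables (T : finType) (e : rel T).

Lemma walkP u v k :
  reflect (exists p, [/\ path e u p, last u p = v & size p = k]) (walk e u v k).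
Proof.
apply: (iffP existsP) => [[p /andP[ep /eqP lp]]|[p [ep lp sp]]].
  by exists p; rewrite size_tuple.
by exists (tcast sp (in_tuple p)); rewrite val_tcast ep lp eqxx.
Qed.

Lemma walk0 u : walk e u u 0.
Proof. by apply/walkP; exists [::]. Qed.

Lemma walk_rcons u v w k : walk e u v k -> e v w -> walk e u w k.+1.
Proof.
move=> /walkP[p [ep lp sp]] vw; apply/walkP; exists (rcons p w).
by rewrite rcons_path ep lp vw last_rcons size_rcons sp.
Qed.

Lemma out_ballP r v u :
  reflect (exists2 k, k <= r & walk e v u k) (u \in out_ball e r v).
Proof.
rewrite inE /dist; case: connect_walkP => [vu|vu].
  case: ex_minnP => m vum minm; apply: (iffP idP) => [mr|[k kr vuk]].
    by exists m.
  exact: leq_trans (minm k vuk) kr.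
by constructor=> -[k _ vuk]; apply: vu; exists k.
Qed.

Lemma out_ball_self r v : v \in out_ball e r v.
Proof. by apply/out_ballP; exists 0; rewrite ?walk0. Qed.

Lemma out_ball1 v u : e v u -> u \in out_ball e 1 v.
Proof. by move=> vu; apply/out_ballP; exists 1; rewrite ?(walk_rcons (walk0 v)). Qed.

End Walks.

Section LayeredMultipacking.
Variables (T : finType) (e : rel T) (lev : T -> nat) (s : T).
Hypothesis lev_arc : forall u v, e u v -> lev v = (lev u).+1.
Hypothesis lev_eq0 : forall v, (lev v == 0) = (v == s).
Hypothesis in_neighbour : forall v, 0 < lev v -> exists u, e u v.

Definition below i : {set T} := [set v | lev v < i].

(* [active i.+1] collects the vertices of level [i] at which a chain of
   vertices on consecutive levels, no vertex being adjacent to the next one, can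
   end, where a new chain is started after each level with no such vertex. *)
Fixpoint active i : {set T} :=
  if i is j.+1 then
    [set v | (lev v == j) &&
       ((active j == set0) || [exists u in active j, ~~ e u v])]
  else set0.

Definition active_levels i := \sum_(j < i) (active j.+1 != set0).

Lemma active_levelsS i :
  active_levels i.+1 = active_levels i + (active i.+1 != set0).
Proof. by rewrite /active_levels big_ord_recr. Qed.

Lemma in_active i v : (v \in active i.+1) =
  (lev v == i) && ((active i == set0) || [exists u in active i, ~~ e u v]).
Proof. by rewrite inE. Qed.

Lemma active_lev i v : v \in active i.+1 -> lev v = i.
Proof. by rewrite in_active => /andP[/eqP]. Qed.

Lemma lev_walk u v k : walk e u v k -> lev v = lev u + k.
Proof.
move=> /walkP[p [ep <- <-]]; elim: p u ep => [|w p IHp] u /=; first by rewrite addn0.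
by case/andP=> /lev_arc uw /IHp ->; rewrite uw addSnnS.
Qed.

Lemma inactive_dominated i a v :
  a \in active i -> lev v = i -> v \notin active i.+1 -> e a v.
Proof.
move=> aA lv; rewrite in_active lv eqxx /= negb_or => /andP[_].
by rewrite negb_exists_in => /forall_inP /(_ a aA); rewrite negbK.
Qed.

Lemma below_sum i : below i.+1 = below i :|: [set v | lev v == i].
Proof. by apply/setP=> v; rewrite !inE ltnS leq_eqVlt orbC. Qed.

(** Walk back from [u] through in-neighbours to level [(lev a).+1], where every vertex is an
    out-neighbour of [a]. *)
Lemma dominating_ball a r u :
  (forall w, lev w = (lev a).+1 -> e a w) ->
  lev a < lev u <= lev a + r -> u \in out_ball e r a.
Proof.
move=> dom /andP[au ur]; apply/out_ballP; exists (lev u - lev a); first by lia.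
have [k Ek] : exists k, lev u = lev a + k.+1.
  by exists (lev u - lev a).-1; lia.
rewrite Ek addKn; elim: k u Ek {au ur} => [|k IHk] u Ek.
  by apply: (walk_rcons (walk0 e a)); apply: dom; rewrite Ek addn1.
have [|w wu] := @in_neighbour u; first by rewrite Ek addnS.
by apply: (walk_rcons _ wu); apply: IHk; move: (lev_arc wu); rewrite Ek; lia.
Qed.

(** * Upper bound on the part of a multipacking below a level *)

Section UpperBound.
Variable S : {set T}.
Hypothesis Smp : multipacking e S.

Lemma card_below_succ i :
  #|S :&: below i.+1| = #|S :&: below i| + #|S :&: [set v | lev v == i]|.
Proof.
rewrite below_sum setIUr cardsU [X in _ - X](_ : _ = 0) ?subn0 //.
apply: eq_card0 => v; rewrite !inE; case: (ltngtP (lev v) i) => //=; by rewrite !(andbF, andbT).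
Qed.

(** [a |: U] lies in the ball of radius 1 around [a], and [a] is outside [U] because arcs raise the
    level. *)
Lemma closed_nbhd_le1 a (U : {set T}) :
  (forall u, u \in U -> e a u) -> (a \in S) + #|S :&: U| <= 1.
Proof.
move=> aU; have aNU : a \notin S :&: U.
  by apply/negP; rewrite inE => /andP[_ /aU /lev_arc]; lia.
have sub : S :&: (a |: U) \subset out_ball e 1 a :&: S.
  apply/subsetP=> u; rewrite !in_setI => /andP[uS]; rewrite uS andbT.
  by case/setU1P=> [->|/aU /out_ball1 //]; apply: out_ball_self.
apply: leq_trans (leq_trans (subset_leq_card sub) (Smp a (leqnn 1))).
rewrite setIUr; have [aS|_] := boolP (a \in S); last first.
  by apply: subset_leq_card; apply: subsetUr.
have -> : S :&: [set a] = [set a] by apply/setIidPr; rewrite sub1set.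
by rewrite cardsU1 aNU.
Qed.

(* If S avoids A_m, its vertices on level m lie in the out-neighbourhood of every
   vertex of A_(m-1): there is at most one, and then S avoids A_(m-1) as well.
   Descending, one reaches an A_l that is a whole level. *)
Lemma avoiding_active_lt m :
  (forall l, l <= m -> #|S :&: below l| <= active_levels l) ->
  active m.+1 != set0 -> [disjoint S & active m.+1] ->
  #|S :&: below m.+1| < active_levels m.+1.
Proof.
elim: m => [|m IHm] U A0 dSA; rewrite ltnNge; apply/negP;
  rewrite active_levelsS A0 card_below_succ addn1 => ge.
all: set c := #|S :&: [set v | lev v == _]| in ge.
  have c0 : c = 0.
    apply: eq_card0 => v; rewrite !in_setI !inE; apply/negP=> /andP[vS lv].
    by have := disjointFr dSA vS; rewrite !inE lv eqxx.
  by move: (U 0 (leqnn 0)); lia.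
have cgt0 : 0 < c by move: (U m.+1 (leqnn _)); lia.
have sub a v : a \in active m.+1 -> v \in S :&: [set v | lev v == m.+1] -> e a v.
  move=> aA; rewrite in_setI inE => /andP[vS /eqP lv].
  by apply: inactive_dominated aA lv _; rewrite (disjointFr dSA vS).
(* Otherwise all of level [m.+1] would be active, and [S], which avoids the active vertices, would
   have none there, against [0 < c]. *)
have Am : active m.+1 != set0.
  apply/eqP=> Am0; case/card_gt0P: cgt0 => v; rewrite in_setI inE => /andP[vS lv].
  by have := disjointFr dSA vS; rewrite in_active lv Am0 eqxx.
have le1 a (aA : a \in active m.+1) : (a \in S) + c <= 1.
  by have := closed_nbhd_le1 (sub a ^~ aA); rewrite setIA setIid.
have dm : [disjoint S & active m.+1].
  apply/pred0P=> a /=; apply/negP=> /andP[aS aA].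
  by have := le1 a aA; rewrite aS; lia.
have [a aA] := set0Pn _ Am.
(* As [c <= 1], at least [active_levels m.+1] vertices of [S] lie below level [m.+1], against the
   induction hypothesis. *)
have := IHm (fun l lm => U l (leqW lm)) Am dm; have := le1 a aA; lia.
Qed.

Lemma active_levels_nonempty i j :
  (forall l, j <= l < i -> active l.+1 != set0) -> j <= i ->
  active_levels i = active_levels j + (i - j).
Proof.
move=> A ji; have [k Ek] : exists k, i = j + k by exists (i - j); lia.
have : j + k <= i by rewrite Ek.
rewrite {2 3}Ek addKn {Ek}; elim: k => [|k IHk] le; first by rewrite !addn0.
have -> : active_levels (j + k.+1) = active_levels (j + k) + 1.
  by rewrite addnS active_levelsS A //; lia.
by rewrite IHk; lia.
Qed.

Lemma level_inhabited i j : j <= i ->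
  (exists v, lev v = i) -> exists v, lev v = j.
Proof.
move=> /subnKC <-; elim: (i - j) => [|k IHk]; first by rewrite addn0.
case=> v lv; apply: IHk; have [|u uv] := @in_neighbour v; first by rewrite lv addnS.
by exists u; move: (lev_arc uv); rewrite lv; lia.
Qed.

Lemma active1 : active 1 = [set s].
Proof. by apply/setP=> v; rewrite in_active eqxx andbT lev_eq0 inE. Qed.

(** The only vertex of level 0 dominates level 1. Hence a last inactive level up to [i] exists
    whenever [0 < i]. *)
Lemma active2 : active 2 = set0.
Proof.
apply/setP=> v; rewrite in_active inE active1; apply/andP=> -[/eqP lv].
case/orP=> [/eqP/setP/(_ s)|/exists_inP[u]]; first by rewrite !inE eqxx.
rewrite inE => /eqP -> /negP; apply; have [|w wv] := @in_neighbour v.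
  by rewrite lv.
by have /eqP <- : w == s by rewrite -lev_eq0; move: (lev_arc wv); rewrite lv; lia.
Qed.

Lemma card_multipacking_below i : #|S :&: below i| <= active_levels i.
Proof.
elim/ltn_ind: i => -[|i] U.
  by rewrite eq_card0 // => v; rewrite !inE andbF.
have [->|i0] := posnP i.
  rewrite active_levelsS active1 -card_gt0 cards1 /active_levels big_ord0.
  apply: leq_trans (_ : #|[set s]| <= _); last by rewrite cards1.
  by apply/subset_leq_card/subsetP=> v; rewrite !inE ltnS leqn0 lev_eq0 => /andP[].
have [/existsP[w /eqP wi]|/existsPn noi] := boolP [exists w, lev w == i]; last first.
  rewrite card_below_succ [X in _ + X]eq_card0 ?addn0; last first.
    by move=> v; rewrite in_setI !inE (negbTE (noi v)) andbF.
  by rewrite active_levelsS; apply: leq_trans (leq_addr _ _); apply: U.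
(* Indices are shifted by one: the active part of level [j] is [active j.+1]. Level 1 witnesses that
   an inactive level exists; level 0 is always active, so the last inactive one is a successor,
   written [j.+1] below. *)
pose P j := (j <= i) && (active j.+1 == set0).
have exP : exists j, P j by exists 1; rewrite /P i0 active2 eqxx.
have boundP j : P j -> j <= i by case/andP.
have [j /andP[ji /eqP Aj0] maxj] := ex_maxnP exP boundP.
case: j ji Aj0 maxj => [|j] ji Aj0 maxj.
  by move: Aj0; rewrite active1 => /setP/(_ s); rewrite !inE eqxx.
have E : active_levels i.+1 = active_levels j.+1 + (i - j.+1).
  rewrite (@active_levels_nonempty _ j.+2) // => [|l /andP[jl li]].
    by rewrite active_levelsS Aj0 eqxx addn0.
  by apply/negP=> A0; have := maxj l; rewrite /P A0 -ltnS li; lia.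
(* Otherwise the whole of level [j.+1], which is inhabited, would be active. *)
have A0 : active j.+1 != set0.
  have [v lv] := level_inhabited ji (ex_intro _ w wi).
  by apply/eqP=> A0; move/setP: Aj0 => /(_ v); rewrite in_active lv A0 !eqxx inE.
rewrite leqNgt; apply/negP; rewrite E => gt.
have Spl : #|S :&: below i.+1| = #|S :&: below j.+1| + #|S :&: (below i.+1 :\: below j.+1)|.
  rewrite -(cardsID (below j.+1)) -setIA -setIDA; congr (#|pred_of_set _| + _).
  by congr (_ :&: _); apply/setIidPr/subsetP=> v; rewrite !inE; lia.
(* Since level [j.+1] is inactive, [a] dominates it, so the ball of radius [i - j] around [a]
   contains the levels [j.+1], ..., [i] and [a] itself. *)
have ballA a : a \in active j.+1 ->
    (a \in S) + #|S :&: (below i.+1 :\: below j.+1)| <= i - j.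
  move=> aA; have la := active_lev aA; set W := _ :\: _.
  have sub : S :&: (a |: W) \subset out_ball e (i - j) a :&: S.
    apply/subsetP=> u; rewrite !in_setI => /andP[uS]; rewrite uS andbT.
    case/setU1P=> [->|]; first exact: out_ball_self.
    move=> uW; apply: dominating_ball; last by move: uW; rewrite !inE la; lia.
    move=> x lx; apply: inactive_dominated aA _ _; first by rewrite lx la.
    by rewrite Aj0 inE.
  apply: leq_trans (leq_trans (subset_leq_card sub) (Smp a _)); last by lia.
  rewrite setIUr; have [aS|_] := boolP (a \in S); last first.
    by apply: subset_leq_card; apply: subsetUr.
  have -> : S :&: [set a] = [set a] by apply/setIidPr; rewrite sub1set.
  by rewrite cardsU1 !inE la ltnSn /= andbF.
(* By [gt] and the induction hypothesis, [S] has at least [i - j] vertices on the levels [j.+1],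
   ..., [i]; one more at [a] would overfill the ball. *)
have dS : [disjoint S & active j.+1].
  apply/pred0P=> a /=; apply/negP=> /andP[aS aA].
  by have := ballA a aA; rewrite aS; have := U j.+1 ji; lia.
(* The ball allows no more than [i - j] vertices there, so [S] attains [active_levels j.+1] below
   level [j.+1] while avoiding [active j.+1]. *)
have [a aA] := set0Pn _ A0; have := ballA a aA.
have := avoiding_active_lt (fun l lj => U l (leq_trans (lj : l < j.+1) (leqW ji))) A0 dS.
lia.
Qed.

End UpperBound.

(** * Lower bound: independent sets with at most one vertex per level *)

Definition independent_transversal (S : {set T}) :=
  {in S &, injective lev} /\ {in S &, forall u v, ~~ e u v}.

(** [lev] injects the part [C] of [S] in the ball into [r + 1] levels, so it suffices to find one of
    them, [z], that [C] misses. If [v] is not in [C], the level of [v] is missed, since the ball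
    contains only [v] there. If it is, the next level is missed: the ball contains only
    out-neighbours of [v] there. *)
Lemma independent_transversal_multipacking S :
  independent_transversal S -> multipacking e S.
Proof.
move=> [injS indS] v r r1; set C := _ :&: S.
have levC u : u \in C -> lev v <= lev u <= lev v + r.
  by rewrite inE => /andP[/out_ballP[k kr /lev_walk ->] _]; lia.
have injC : {in C &, injective lev}.
  by move=> u w; rewrite !inE => /andP[_ uS] /andP[_ wS]; apply: injS.
have CS u : u \in C -> u \in S by rewrite inE => /andP[].
have uni : uniq [seq lev u | u <- enum C].
  by rewrite map_inj_in_uniq ?enum_uniq // => u w; rewrite !mem_enum; apply: injC.
have [/andP[vC /existsP[w /andP[wC /eqP lw]]]|nvw] :=
    boolP ((v \in C) && [exists w, (w \in C) && (lev w == (lev v).+1)]).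
  have := indS v w (CS _ vC) (CS _ wC).
  have [k kr vw] : exists2 k, k <= r & walk e v w k.
    by apply/out_ballP; move: wC; rewrite inE => /andP[].
  have k1 : k = 1 by move: (lev_walk vw); lia.
  case/walkP: vw => -[|x [|? ?]] [ep lp sp] //; rewrite ?k1 // in sp.
  by move: ep lp => /= /andP[vx _] <-; rewrite vx.
have [z zr zC] : exists2 z, lev v <= z <= lev v + r &
                   forall u, u \in C -> lev u != z.
  case/nandP: nvw => [vC|/existsPn nw].
    exists (lev v) => [|u uC]; first by lia.
    apply: contra vC => /eqP lu; suff <- : u = v by [].
    move: uC; rewrite inE => /andP[/out_ballP[k _ vu] _].
    move: (lev_walk vu) => lk; have k0 : k = 0 by lia.
    by case/walkP: vu => -[|? ?] [_ <- sp]; rewrite ?k0 // in sp.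
  exists (lev v).+1 => [|u uC]; first by lia.
  by have := nw u; rewrite uC.
rewrite cardE -(size_map lev).
have sub : {subset [seq lev u | u <- enum C] <= rem z (iota (lev v) r.+1)}.
  move=> _ /mapP[u + ->]; rewrite mem_enum => uC.
  rewrite (mem_rem_uniq _ (iota_uniq _ _)) !inE zC // mem_iota.
  by have := levC u uC; lia.
have := uniq_leq_size uni sub; rewrite size_rem ?size_iota // mem_iota; lia.
Qed.

Lemma independent_transversal_extend (S : {set T}) i w :
  independent_transversal S -> S \subset below i -> lev w = i ->
  (forall u, u \in S -> ~~ e u w) ->
  [/\ independent_transversal (w |: S), w |: S \subset below i.+1
    & #|w |: S| = #|S|.+1].
Proof.
move=> [injS indS] /subsetP Si lw Sw.
have lS u : u \in S -> lev u < i by move=> /Si; rewrite inE.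
split; first split.
- move=> u v /setU1P[->|uS] /setU1P[->|vS] //; last exact: injS.
    by move: (lS v vS); lia.
  by move: (lS u uS); lia.
- move=> u v /setU1P[->|uS] /setU1P[->|vS]; [| |exact: Sw|exact: indS].
    by apply/negP=> /lev_arc; lia.
  by apply/negP=> /lev_arc; move: (lS v vS); lia.
- apply/subsetP=> u /setU1P[->|/lS]; rewrite inE; lia.
by rewrite cardsU1; case: (boolP (w \in S)) => // /lS; lia.
Qed.

(** The second half prescribes the top vertex, so that a non-adjacent vertex of the next level can
    be added; the first half serves to restart after a level with no active vertex. *)
Lemma independent_transversal_exists i :
  (exists S, [/\ independent_transversal S, S \subset below i & #|S| = active_levels i])
  /\ forall w, w \in active i.+1 ->
     exists S, [/\ independent_transversal S, S \subset below i.+1,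
                   w \in S & #|S| = active_levels i.+1].
Proof.
elim: i => [|i [IH1 IH2]].
  have T0 : independent_transversal set0 by split=> u v; rewrite inE.
  split.
    by exists set0; rewrite sub0set cards0 /active_levels big_ord0.
  move=> w wA; have [] := @independent_transversal_extend set0 0 w T0 (sub0set _) (active_lev wA).
    by move=> u; rewrite inE.
  move=> WT Wi cW; exists (w |: set0); split=> //; first by rewrite setU11.
  have A0 : active 1 != set0 by apply/set0Pn; exists w.
  by rewrite cW cards0 active_levelsS A0 /active_levels big_ord0.
have [A0|/set0Pn[u uA]] := eqVneq (active i.+1) set0.
  have [S [ST Si cS]] := IH1.
  have Si1 : S \subset below i.+1.
    by apply: subset_trans Si _; apply/subsetP=> v; rewrite !inE => /leqW.
  split.
    by exists S; rewrite active_levelsS A0 eqxx addn0.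
  move=> w wA; have [|WT Wi cW] := independent_transversal_extend ST Si1 (active_lev wA).
    move=> v vS; apply/negP=> /lev_arc; rewrite (active_lev wA).
    by move/subsetP: Si => /(_ v vS); rewrite inE; lia.
  exists (w |: S); split=> //; first by rewrite setU11.
  have Aw : active i.+2 != set0 by apply/set0Pn; exists w.
  by rewrite cW cS 2!active_levelsS A0 eqxx Aw; lia.
split; first by have [S [ST Si _ cS]] := IH2 u uA; exists S.
move=> w wA; have lw := active_lev wA.
have [x xA xw] : exists2 x, x \in active i.+1 & ~~ e x w.
  move: wA; rewrite in_active => /andP[_ /orP[/eqP A0|/exists_inP //]].
  by move: uA; rewrite A0 inE.
have [S [ST Si xS cS]] := IH2 x xA.
have [|WT Wi cW] := independent_transversal_extend ST Si lw.
  (* An arc from [S] to [w] starts on level [i], where [x] is the only vertex of [S]. *)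
  move=> v vS; apply/negP=> vw; move/negP: xw; apply.
  suff -> : x = v by [].
  by case: ST => injS _; apply: injS => //; rewrite (active_lev xA); move: (lev_arc vw); lia.
exists (w |: S); split=> //; first by rewrite setU11.
have Aw : active i.+2 != set0 by apply/set0Pn; exists w.
by rewrite cW cS (active_levelsS i.+1) Aw addn1.
Qed.

Lemma max_multipacking_active_levels i :
  (forall v, lev v < i) -> max_multipacking_size e (active_levels i).
Proof.
move=> levi; have belowT : below i = setT by apply/setP=> v; rewrite !inE levi.
split=> [|S Smp]; last by rewrite -[S]setIT -belowT; apply: card_multipacking_below.
have [[S [ST _ cS]] _] := independent_transversal_exists i.
by exists S; split=> //; apply: independent_transversal_multipacking.
Qed.

End LayeredMultipacking.

(** * Running programs *)

Section Runs.
Variable p : program.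

(** Asking for [Q] within [t] steps, rather than after exactly [t], lets branches of different
    lengths share a bound. *)
Definition runs_to (t : nat) (c : config) (Q : config -> Prop) :=
  exists2 k, k <= t & Q (iter k (step p) c).

Lemma runs_to_here c (Q : config -> Prop) t : Q c -> runs_to t c Q.
Proof. by exists 0. Qed.

Lemma runs_to_step i c Q t :
  onth p (pc c) = Some i -> runs_to t (exec i c) Q -> runs_to t.+1 c Q.
Proof. by move=> pi [k kt Qk]; exists k.+1; rewrite // iterSr /step pi. Qed.

Lemma runs_to_bind c Q1 Q t1 t :
  runs_to t1 c Q1 -> t1 <= t -> (forall c', Q1 c' -> runs_to (t - t1) c' Q) ->
  runs_to t c Q.
Proof.
move=> [k kt1 Qk] t1t QQ; have [l lt Ql] := QQ _ Qk.
by exists (l + k); [lia | rewrite iterD].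
Qed.

Lemma runs_to_bind_le c Q1 Q t1 t2 :
  runs_to t1 c Q1 -> (forall c', Q1 c' -> runs_to t2 c' Q) ->
  runs_to (t1 + t2) c Q.
Proof. by move=> H H'; apply: (runs_to_bind H); rewrite ?leq_addr // addKn. Qed.

Lemma runs_to_le c Q t1 t : runs_to t1 c Q -> t1 <= t -> runs_to t c Q.
Proof. by move=> [k kt1 Qk] t1t; exists k; first exact: leq_trans t1t. Qed.

Lemma halted_step c : halted p c -> step p c = c.
Proof. by rewrite /halted /step => /onth_default ->. Qed.

Lemma halted_iter c k : halted p c -> iter k (step p) c = c.
Proof. by move=> hc; elim: k => //= k ->; apply: halted_step. Qed.

End Runs.

(** * Syntactic control of the word size *)

Section WordSize.
(* Registers in [flag] only ever hold 0 or 1.  Adding a flag is the only way to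
   increase a register of level 0 beyond what it was copied or read from, so
   that level 0 registers and memory cells grow by at most one per step; an
   arbitrary sum goes to a register of a higher level. *)
Variables (flag : pred nat) (level : nat -> nat).

Definition leveled (i : instr) : bool :=
  match i with
  | Const _ k => k <= 1
  | Copy r s => ~~ flag r && (level s <= level r)
  | Add r s t => ~~ flag r && ((level s <= level r) && flag t
                              || (level s < level r) && (level t < level r))
  | Defs.Sub r s _ => ~~ flag r && (level s <= level r)
  | Read r _ => ~~ flag r
  | Write _ s => level s == 0
  | Jump _ => true
  | Jzero _ _ => true
  end.

Definition level_bounded (b : nat) (c : config) :=
  [/\ forall r, reg c r <= 2 ^ level r * b, forall r, flag r -> reg c r <= 1
    & forall a, memory c a <= b].

(** Adding a flag costs at most 1, which is absorbed by passing to [b.+1]; a sum of two registers of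
    lower level at most doubles their bound, which is absorbed by the factor [2 ^ level r]. *)
Lemma exec_level_bounded b i c :
  0 < b -> leveled i -> level_bounded b c -> level_bounded b.+1 (exec i c).
Proof.
case: c => pc R M b0 li [/= Rb Rf Mb].
have pow r : 0 < 2 ^ level r by rewrite expn_gt0.
have mono r s : level s <= level r -> 2 ^ level s * b <= 2 ^ level r * b.
  by move=> sr; rewrite leq_mul2r leq_pexp2l ?orbT.
have mono2 r s : level s < level r -> 2 * (2 ^ level s * b) <= 2 ^ level r * b.
  by move=> sr; rewrite mulnA -expnS leq_mul2r leq_pexp2l ?orbT.
have Rb' r : R r <= 2 ^ level r * b.+1 by rewrite mulnS; apply: leq_trans (Rb r) (leq_addl _ _).
have Mb' a : M a <= b.+1 by apply: leqW.
have bump r : b < 2 ^ level r * b.+1 by move: (pow r); nia.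
have updR r v l : v <= 2 ^ level r * b.+1 -> (flag r -> v <= 1) ->
    level_bounded b.+1 (Config l (upd R r v) M).
  move=> vb vf; split=> //= r'; rewrite /upd; case: eqP => [->|_] //; exact: Rf.
case: i li => [r k|r s|r s t|r s t|r s|r s|l|r l] /= => [k1|/andP[/negP fr sr]
  |/andP[/negP fr /orP[/andP[sr ft]|/andP[sr tr]]]|/andP[/negP fr sr]|/negP fr|/eqP s0|_|_];
  try (apply: updR => [|//]).
- by move: (pow r); nia.
- by move: (Rb s) (mono r s sr); rewrite mulnS; lia.
- by move: (Rb s) (Rf t ft) (mono r s sr) (pow r); rewrite mulnS; lia.
- by move: (Rb s) (Rb t) (mono2 r s sr) (mono2 r t tr); rewrite mulnS; lia.
- by move: (Rb s) (mono r s sr); rewrite mulnS; lia.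
- by move: (Mb (R s)) (bump r); lia.
- split=> //= a; rewrite /upd; case: eqP => // _.
  by move: (Rb s); rewrite s0 mul1n; lia.
- by split.
- by split.
Qed.

Lemma run_level_bounded (p : program) b c k :
  0 < b -> all leveled p -> level_bounded b c ->
  level_bounded (b + k) (iter k (step p) c).
Proof.
move=> b0 /all_nthP lp cb; elim: k => [|k IHk]; first by rewrite addn0.
rewrite addnS iterS /step; case pi: (onth p _) => [i|].
  apply: exec_level_bounded => //; first by lia.
  rewrite -(@onth_nth _ i _ _ _ pi); apply: lp.
  by rewrite -onthTE pi.
case: IHk => Rb Rf Mb; split=> // [r|a].
  by apply: leq_trans (Rb r) _; rewrite leq_mul2l leqnSn orbT.
by apply: leqW.
Qed.

Lemma init_level_bounded x :
  (forall r, flag r -> r != 0) ->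
  level_bounded (size x + \max_(w <- x) w).+1 (init x).
Proof.
move=> f0; split=> /= [r|r /f0|a].
- rewrite /upd; case: eqP => //= _; apply: leq_trans (_ : 1 * (size x).+1 <= _); first by lia.
  by apply: leq_mul; rewrite ?expn_gt0 // ltnS leq_addr.
- by rewrite /upd; case: eqP.
have [ax|ax] := ltnP a (size x); last by rewrite nth_default.
have : nth 0 x a <= \max_(w <- x) w by apply: leq_bigmax_seq; rewrite ?mem_nth.
lia.
Qed.

Lemma computes_of_run (p : program) x (ans : nat -> Prop) c0 m :
  (forall r, flag r -> r != 0) -> (forall r, level r <= m) -> all leveled p ->
  0 < size x ->
  runs_to p (c0 * size x) (init x) (fun c => halted p c /\ ans (reg c 0)) ->
  let c := 2 ^ m * c0.+2 in
  exists y, ans y /\ computes p x y (c * size x) (c * (size x + \max_(w <- x) w)).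
Proof.
move=> f0 lm lp x0 [t tc [ht yt]] c.
exists (reg (run p x t) 0); split=> //.
have m0 : 0 < 2 ^ m by rewrite expn_gt0.
have tle : t <= c * size x by apply: leq_trans tc _; rewrite leq_mul2r /c; apply/orP; right; nia.
have after k : t <= k -> run p x k = run p x t.
  by move=> /subnK <-; rewrite /run iterD halted_iter.
split; rewrite ?(after _ tle) // => k a.
set W := _ + \max_(w <- x) w.
have [j jt ->] : exists2 j, j <= t & run p x k = run p x j.
  by have [kt|/ltnW tk] := leqP k t; [exists k | exists t; rewrite ?after].
have [Rb _ Mb] := run_level_bounded j (ltn0Sn _) lp (init_level_bounded x f0).
(* The bound starts at [W.+1] and rises by one in each of at most [c0 * size x] steps;
   [0 < size x <= W] absorbs the rest. The factor [2 ^ m] of [c] is for the levels. *)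
have jb : W.+1 + j <= c0.+2 * W.
  by move: tc jt x0; rewrite /W; nia.
have wb l : l <= m -> 2 ^ l * (W.+1 + j) <= c * W.
  move=> lem; apply: (@leq_trans (2 ^ m * (c0.+2 * W))).
    by rewrite leq_mul // leq_pexp2l.
  by rewrite mulnA.
split; first exact: leq_trans (Rb a) (wb _ (lm _)).
by apply: leq_trans (Mb a) _; move: (wb 0 (leq0n _)); rewrite mul1n.
Qed.

End WordSize.

(** * The program *)

Local Notation rBase := 0 (only parsing).
Local Notation rOne := 1 (only parsing).
Local Notation rOrder := 2 (only parsing).
Local Notation rTodo := 3 (only parsing).
Local Notation rCount := 4 (only parsing).
Local Notation rQueue := 5 (only parsing).
Local Notation rVertex := 6 (only parsing).
Local Notation rPtr := 7 (only parsing).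
Local Notation rLeft := 8 (only parsing).
Local Notation rAddr := 9 (only parsing).
Local Notation rHeadVertex := 10 (only parsing).
Local Notation rTmp := 11 (only parsing).
Local Notation rHead := 12 (only parsing).
Local Notation rTail := 13 (only parsing).
Local Notation rEnd := 14 (only parsing).
Local Notation rPrev := 15 (only parsing).
Local Notation rCur := 16 (only parsing).
Local Notation rFlag := 17 (only parsing).
Local Notation rAns := 18 (only parsing).

(* Memory from address L, the length of the input, on: the n addresses of the
   adjacency lists; n flags, first set at the vertices with an in-neighbour and
   later cleared when a vertex enters the queue; n counters of in-neighbours in the
   active part of the previous level; the queue.  The numbers are jump targets, and
   the program ends at 70. *)
Definition layers_program : program := [::
  Const rOne 1; Read rOrder rVertex;
  Add rTodo rBase rOrder; Add rCount rTodo rOrder; Add rQueue rCount rOrder;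
  Copy rPtr rOne;
  (*  6 *) Defs.Sub rTmp rOrder rVertex; Jzero rTmp 21;
  Add rAddr rBase rVertex; Write rAddr rPtr; Read rLeft rPtr;
  Add rPtr rPtr rOne;
  (* 12 *) Jzero rLeft 19; Read rHeadVertex rPtr; Add rAddr rTodo rHeadVertex;
  Write rAddr rOne; Add rPtr rPtr rOne; Defs.Sub rLeft rLeft rOne; Jump 12;
  (* 19 *) Add rVertex rVertex rOne; Jump 6;
  (* 21 *) Const rVertex 0;
  (* 22 *) Add rAddr rTodo rVertex; Read rTmp rAddr; Jzero rTmp 27;
  Add rVertex rVertex rOne; Jump 22;
  (* 27 *) Write rQueue rVertex; Copy rTail rOne;
  (* 29 *) Defs.Sub rTmp rTail rHead; Jzero rTmp 70; Copy rEnd rTail;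
  Const rCur 0;
  (* 33 *) Defs.Sub rTmp rEnd rHead; Jzero rTmp 66; Add rAddr rQueue rHead;
  Read rVertex rAddr; Add rHead rHead rOne; Const rFlag 0; Jzero rPrev 44;
  Add rAddr rCount rVertex; Read rTmp rAddr; Defs.Sub rTmp rPrev rTmp;
  Jzero rTmp 45;
  (* 44 *) Const rFlag 1;
  (* 45 *) Add rCur rCur rFlag; Add rAddr rBase rVertex; Read rPtr rAddr;
  Read rLeft rPtr;
  (* 49 *) Jzero rLeft 33; Add rPtr rPtr rOne; Read rHeadVertex rPtr;
  Defs.Sub rLeft rLeft rOne; Add rAddr rTodo rHeadVertex; Read rTmp rAddr;
  Jzero rTmp 61; Const rTmp 0; Write rAddr rTmp; Add rAddr rQueue rTail;
  Write rAddr rHeadVertex; Add rTail rTail rOne;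
  (* 61 *) Add rAddr rCount rHeadVertex; Read rTmp rAddr; Add rTmp rTmp rFlag;
  Write rAddr rTmp; Jump 49;
  (* 66 *) Copy rPrev rCur; Jzero rCur 29; Add rAns rAns rOne; Jump 29 ].

Definition flag_register : pred nat := [pred r | (r == rOne) || (r == rFlag)].

(** The three base addresses are successive sums, each one level above the previous one; [rAddr]
    adds an index to any of them. *)
Definition register_level (r : nat) : nat :=
  if r == rTodo then 1 else if r == rCount then 2 else if r == rQueue then 3
  else if r == rAddr then 4 else 0.

Definition size_program : program := layers_program ++ [:: Copy rBase rAns].

(* Entered at 70; the bound k is the last input word, and 76 is the end. *)
Definition decision_code : program :=
  [:: Defs.Sub rAddr rBase rOne; Read rHeadVertex rAddr;
      Defs.Sub rTmp rHeadVertex rAns; Const rBase 1; Jzero rTmp 76; Const rBase 0 ].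

Definition decision_program : program := layers_program ++ decision_code.

Lemma register_level_le4 r : register_level r <= 4.
Proof. by rewrite /register_level; do !case: ifP => // _. Qed.

Lemma size_program_leveled : all (leveled flag_register register_level) size_program.
Proof. by []. Qed.

Lemma decision_program_leveled : all (leveled flag_register register_level) decision_program.
Proof. by []. Qed.

(** * Correctness of the program *)

Lemma updE f a w b : upd f a w b = if b == a then w else f b.
Proof. by []. Qed.

Ltac exec1 := eapply runs_to_step; [reflexivity | cbn [exec]; rewrite ?updE /=].

Ltac frame :=
  let r := fresh "r" in
  move=> r; rewrite !inE ?negb_or !updE; repeat (case: eqP => [->|_] //).

Section Simulation.
Variables (x : seq nat) (n : nat) (post : program).
Let L := size x.
Let P := layers_program ++ post.

Record layout (M off todo cnt q : nat -> nat) : Prop := Layout {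
  layout_input : forall i, i < L -> M i = nth 0 x i;
  layout_off : forall i, i < n -> M (L + i) = off i;
  layout_todo : forall i, i < n -> M (L + n + i) = todo i;
  layout_cnt : forall i, i < n -> M (L + n + n + i) = cnt i;
  layout_queue : forall i, M (L + n + n + n + i) = q i }.

Lemma layout_ext M off todo cnt q off' todo' cnt' q' :
  layout M off todo cnt q ->
  (forall i, i < n -> off i = off' i) -> (forall i, i < n -> todo i = todo' i) ->
  (forall i, i < n -> cnt i = cnt' i) -> q =1 q' ->
  layout M off' todo' cnt' q'.
Proof.
case=> Li Lo Lt Lc Lq Eo Et Ec Eq; split=> // i.
- by move=> ni; rewrite Lo ?Eo.
- by move=> ni; rewrite Lt ?Et.
- by move=> ni; rewrite Lc ?Ec.
- by rewrite Lq Eq.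
Qed.

Section Writes.
Variables (M off todo cnt q : nat -> nat) (i v : nat).
Hypothesis MM : layout M off todo cnt q.

Local Ltac separate Li Lo Lt Lc Lq := split=> j;
  rewrite ?updE ?Lq; repeat (case: eqP => ?); try lia;
  move=> jn; rewrite ?Lo ?Lt ?Lc ?Li //; lia.

Lemma layout_write_off : i < n -> layout (upd M (L + i) v) (upd off i v) todo cnt q.
Proof. by case: MM => Li Lo Lt Lc Lq; separate Li Lo Lt Lc Lq. Qed.

Lemma layout_write_todo :
  i < n -> layout (upd M (L + n + i) v) off (upd todo i v) cnt q.
Proof. by case: MM => Li Lo Lt Lc Lq; separate Li Lo Lt Lc Lq. Qed.

Lemma layout_write_cnt :
  i < n -> layout (upd M (L + n + n + i) v) off todo (upd cnt i v) q.
Proof. by case: MM => Li Lo Lt Lc Lq; separate Li Lo Lt Lc Lq. Qed.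

Lemma layout_write_queue : layout (upd M (L + n + n + n + i) v) off todo cnt (upd q i v).
Proof. by case: MM => Li Lo Lt Lc Lq; separate Li Lo Lt Lc Lq. Qed.

End Writes.

Definition bases (R : nat -> nat) :=
  [/\ R rBase = L, R rOne = 1, R rOrder = n
    & [/\ R rTodo = L + n, R rCount = L + n + n & R rQueue = L + n + n + n]].

(** The frame condition of a code fragment that may write the registers [rs]. *)
Definition same_except (rs : seq nat) (R R' : nat -> nat) :=
  forall r, r \notin rs -> R' r = R r.

Lemma same_except_trans rs1 rs2 rs R R' R'' :
  same_except rs1 R R' -> same_except rs2 R' R'' ->
  all (mem rs) (rs1 ++ rs2) -> same_except rs R R''.
Proof.
rewrite all_cat => RR' R'R'' /andP[/allP rs1s /allP rs2s] r rrs.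
by rewrite R'R'' ?RR' //; apply: contra rrs; [apply: rs1s | apply: rs2s].
Qed.

Lemma same_except_bases rs R R' :
  all (ltn rQueue) rs -> same_except rs R R' -> bases R -> bases R'.
Proof.
move=> /allP rs5 RR' [R0 R1 R2 [R3 R4 R5]].
by split; [| | |split]; rewrite RR' //; apply/negP=> /rs5.
Qed.

Definition segment l a := prefix l (drop a x).

Lemma segment_cons w l a :
  segment (w :: l) a -> [/\ a < L, nth 0 x a = w & segment l a.+1].
Proof.
rewrite /segment; have [La|aL] := leqP L a; first by rewrite drop_oversize.
by rewrite (drop_nth 0) // prefix_cons => /andP[/eqP -> ->].
Qed.

(** The loop at 12 spends seven instructions per neighbour and one on the final exit test. *)
Lemma mark_loop l R M off todo cnt q :
  bases R -> layout M off todo cnt q -> R rLeft = size l ->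
  segment l (R rPtr) -> all (ltn^~ n) l ->
  runs_to P (7 * size l).+1 (Config 12 R M) (fun c =>
    [/\ pc c = 19, reg c rPtr = R rPtr + size l,
        same_except [:: rPtr; rLeft; rAddr; rHeadVertex] R (reg c) &
        layout (memory c) off (fun w => if w \in l then 1 else todo w) cnt q]).
Proof.
elim: l R M todo => [|w l IHl] R M todo Rb MM Rl sl ln.
  exec1; rewrite Rl /=; apply: runs_to_here; split=> //=; first by rewrite addn0.
have [aL xa sl'] := segment_cons sl; have /andP[wn ln'] := ln.
have [R0 R1 R2 [R3 R4 R5]] := Rb.
apply: (@runs_to_le _ _ _ (7 + (7 * size l).+1)); last by rewrite /=; lia.
exec1; rewrite Rl /=; do 6 exec1.
rewrite R1 R3 (layout_input MM) // xa.
set R' := upd _ _ _; set M' := upd _ _ _.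
have RR' : same_except [:: rPtr; rLeft; rAddr; rHeadVertex] R R'.
  by rewrite /R'; frame.
have Rb' : bases R' by apply: same_except_bases RR' Rb.
have MM' := layout_write_todo 1 MM wn.
have R'p : R' rPtr = (R rPtr).+1 by rewrite /R' !updE /= addn1.
apply: (runs_to_bind (IHl R' M' _ Rb' MM' _ _ ln')).
- by rewrite /R' !updE /= Rl /= subn1.
- by rewrite R'p.
- by [].
move=> [k R'' M''] [/= -> R''p R'R'' MM2].
apply: runs_to_here; split=> //=.
- by rewrite R''p R'p addSnnS.
- by move=> r rs; rewrite R'R'' // RR'.
apply: layout_ext MM2 _ _ _ _ => //= j jn.
by rewrite updE in_cons; case: eqP; case: (j \in l).
Qed.

Section Adjacency.
Variable a : nat -> seq nat.

(** The leading 1 skips the number of vertices; the successor counts the out-degree stored before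
    each list. *)
Definition offset u := 1 + \sum_(v < u) (size (a v)).+1.

(** The flags after scanning the first [u] lists; for [u = n] they are clear exactly at the
    sources. *)
Definition is_head u w : bool := has (fun v => w \in a v) (iota 0 u).

Hypothesis segment_offset : forall u, u < n -> segment (size (a u) :: a u) (offset u).
Hypothesis adj_ltn : forall u, u < n -> all (ltn^~ n) (a u).

(** Here [k] lists remain to be scanned. Each costs 9 steps besides the 7 per arc: 6 to enter it, 1
    for the exit test of [mark_loop], 2 to move on. *)
Lemma scan_loop k R M off cnt q :
  bases R -> R rVertex + k = n -> R rPtr = offset (R rVertex) ->
  layout M off (is_head (R rVertex)) cnt q ->
  (forall v, v < R rVertex -> off v = offset v) ->
  runs_to P (\sum_(R rVertex <= v < n) (7 * size (a v) + 9) + 2) (Config 6 R M)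
    (fun c => [/\ pc c = 21,
      same_except [:: rVertex; rPtr; rLeft; rAddr; rHeadVertex; rTmp] R (reg c) &
      layout (memory c) offset (is_head n) cnt q]).
Proof.
elim: k R M off => [|k IHk] R M off Rb; have [R0 R1 R2 [R3 R4 R5]] := Rb.
  rewrite addn0 => Rn Rp MM offE; rewrite Rn big_geq // add0n.
  exec1; exec1; rewrite R2 Rn subnn /=; apply: runs_to_here; split=> //=.
    by frame.
  by rewrite -Rn; apply: layout_ext MM _ _ _ _ => // i; rewrite -{1}Rn; apply: offE.
move=> Rk Rp MM offE; set u := R rVertex in Rk Rp MM offE *.
have un : u < n by lia.
have [offL offx seg] := segment_cons (segment_offset un).
rewrite big_ltn //; set B := \sum_(_ <= _ < _) _.
apply: (@runs_to_le _ _ _ (6 + ((7 * size (a u)).+1 + (2 + (B + 2))))); last by lia.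
exec1; exec1; have -> : R rOrder - R rVertex == 0 = false by rewrite R2 -/u; lia.
do 4 exec1; rewrite !R0 -/u.
set R' := upd _ _ _; set M' := upd _ _ _.
have RR' : same_except [:: rPtr; rLeft; rAddr; rTmp] R R' by rewrite /R'; frame.
have Rb' : bases R' by apply: same_except_bases RR' Rb.
have MM' := layout_write_off (R rPtr) MM un.
have R'p : R' rPtr = (offset u).+1 by rewrite /R' !updE /= R1 Rp addn1.
apply: (runs_to_bind (@mark_loop (a u) R' M' _ _ _ _ Rb' MM' _ _ (adj_ltn un))).
- rewrite /R' !updE /= Rp; case: eqP => [|_]; last by rewrite (layout_input MM).
  by move: offL; lia.
- by rewrite R'p.
- by rewrite leq_addr.
move=> [_ R2' M2] [/= -> R2p RR2 MM2]; rewrite addKn.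
have Rb2 : bases R2' by apply: same_except_bases RR2 Rb'.
have [_ R21 _ _] := Rb2.
exec1; exec1; rewrite R21.
set R3' := upd _ _ _.
have R3v : R3' rVertex = u.+1 by rewrite /R3' !updE /= RR2 // RR' // addn1.
have R23 : same_except [:: rVertex] R2' R3' by rewrite /R3'; frame.
apply: (runs_to_bind (IHk R3' M2 _ _ _ _ _ _)).
- by apply: same_except_bases R23 Rb2.
- by rewrite R3v; lia.
- rewrite R3v R23 // R2p R'p /offset big_ord_recr /=; lia.
- rewrite R3v; apply: layout_ext MM2 _ _ _ _ => // w wn.
  rewrite /is_head -[u.+1]addn1 iotaD has_cat /= orbF.
  by case: (w \in a u); rewrite ?orbT ?orbF.
- move=> v; rewrite R3v updE ltnS leq_eqVlt; case: eqP => [-> //|_] /=.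
  exact: offE.
- by rewrite R3v.
move=> [_ R4' M4] [/= -> RR4 MM4]; apply: runs_to_here; split=> //=.
have F2 : same_except [:: rVertex; rPtr; rLeft; rAddr; rHeadVertex; rTmp] R R2'.
  by apply: same_except_trans RR' RR2 _.
have F3 : same_except [:: rVertex; rPtr; rLeft; rAddr; rHeadVertex; rTmp] R R3'.
  by apply: same_except_trans F2 R23 _.
by apply: same_except_trans F3 RR4 _.
Qed.

Lemma source_loop k s R M off todo cnt q :
  bases R -> layout M off todo cnt q -> R rVertex + k = s -> s < n ->
  todo s = 0 -> (forall w, w < s -> todo w != 0) ->
  runs_to P (5 * k + 3) (Config 22 R M)
    (fun c => [/\ pc c = 27, reg c rVertex = s,
      same_except [:: rVertex; rAddr; rTmp] R (reg c) & memory c = M]).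
Proof.
elim: k R => [|k IHk] R Rb MM Rs sn ts ws; have [R0 R1 R2 [R3 R4 R5]] := Rb.
  have {}Rs : R rVertex = s by rewrite -Rs addn0.
  exec1; exec1; exec1. rewrite R3 Rs (layout_todo MM) // ts /=.
  by apply: runs_to_here; split=> //=; frame.
apply: (@runs_to_le _ _ _ (5 + (5 * k + 3))); last by lia.
have un : R rVertex < s by lia.
do 3 exec1; rewrite R3 (layout_todo MM); last by lia.
rewrite (negbTE (ws _ un)); do 2 exec1; rewrite R1.
set R' := upd _ _ _.
have RR' : same_except [:: rVertex; rAddr; rTmp] R R' by rewrite /R'; frame.
apply: (runs_to_bind (IHk R' _ MM _ sn ts ws)).
- by apply: same_except_bases RR' Rb.
- by rewrite /R' !updE /=; lia.
- by [].
move=> [_ R'' M''] [/= -> R''v R'R'' ->]; apply: runs_to_here; split=> //= r rs.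
by rewrite R'R'' ?RR'.
Qed.

(** The list keeps the vertices already served, so membership means having been discovered, which is
    what a cleared flag records. *)
Definition enqueue (qs l : seq nat) :=
  foldl (fun qs w => if w \in qs then qs else rcons qs w) qs l.

Lemma mem_enqueue qs l w : (w \in enqueue qs l) = (w \in qs) || (w \in l).
Proof.
elim: l qs => [|v l IHl] qs /=; first by rewrite orbF.
rewrite IHl in_cons; case: ifP => [vq|_]; last first.
  by rewrite mem_rcons in_cons -orbA orbCA.
by case: eqP => [->|_] //=; rewrite vq.
Qed.

Lemma enqueue_uniq qs l : uniq qs -> uniq (enqueue qs l).
Proof.
elim: l qs => //= v l IHl qs uq; apply: IHl; case: ifPn => // vq.
by rewrite rcons_uniq vq.
Qed.

Lemma prefix_enqueue qs l : prefix qs (enqueue qs l).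
Proof.
elim: l qs => [|v l IHl] qs /=; first exact: prefix_refl.
apply: prefix_trans (IHl _); case: ifP => _; rewrite ?prefix_refl //.
exact: prefix_rcons.
Qed.

Lemma enqueue_cat qs l1 l2 : enqueue qs (l1 ++ l2) = enqueue (enqueue qs l1) l2.
Proof. exact: foldl_cat. Qed.

Lemma nth_rcons_upd qs w i : nth 0 (rcons qs w) i = upd (nth 0 qs) (size qs) w i.
Proof.
by rewrite updE nth_rcons; case: ltngtP => // ?; rewrite nth_default //; lia.
Qed.

Definition queue_layout M cnt qs :=
  layout M offset (fun w => w \notin qs) cnt (nth 0 qs).

(** [rPtr] stays one cell before the next neighbour, hence the successor. With [rFlag] equal to 1
    for an active tail and 0 otherwise, the additions count active in-neighbours. *)
Lemma arc_loop l R M cnt qs :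
  bases R -> queue_layout M cnt qs -> R rLeft = size l ->
  segment l (R rPtr).+1 -> all (ltn^~ n) l -> R rTail = size qs ->
  runs_to P (17 * size l).+1 (Config 49 R M) (fun c =>
    [/\ pc c = 33, reg c rTail = size (enqueue qs l),
        same_except [:: rPtr; rLeft; rAddr; rHeadVertex; rTmp; rTail] R (reg c) &
        queue_layout (memory c) (fun w => cnt w + R rFlag * count_mem w l) (enqueue qs l)]).
Proof.
elim: l R M cnt qs => [|w l IHl] R M cnt qs Rb MM Rl sl ln Rt.
  exec1; rewrite Rl /=; apply: runs_to_here; split=> //=.
  by apply: layout_ext MM _ _ _ _ => //= i _; rewrite muln0 addn0.
have [aL xa sl'] := segment_cons sl; have /andP[wn ln'] := ln.
have [R0 R1 R2 [R3 R4 R5]] := Rb.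
apply: (@runs_to_le _ _ _ (17 + (17 * size l).+1)); last by rewrite /=; lia.
exec1; rewrite Rl /=; do 6 exec1; rewrite Rl /= R1 addn1 (layout_input MM aL) xa R3 subn1 /=.
rewrite (layout_todo MM) //.
set R' := upd _ _ _.
have RR' : same_except [:: rPtr; rLeft; rAddr; rHeadVertex; rTmp] R R'.
  by rewrite /R'; frame.
pose qs' := enqueue qs [:: w].
have : runs_to P 5 (Config (if (w \notin qs) == 0 :> nat then 61 else 56) R' M)
    (fun c => [/\ pc c = 61, reg c rTail = size qs',
       same_except [:: rAddr; rTmp; rTail] R' (reg c) & queue_layout (memory c) cnt qs']).
  rewrite /qs' /=; have [wq|wq] /= := boolP (w \in qs).
    by apply: runs_to_here; split=> //=; rewrite RR'.
  do 5 exec1; rewrite /R' !updE /= R1 R5 Rt; apply: runs_to_here; split=> //=.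
  - by rewrite size_rcons addn1.
  - by frame.
  have MM1 := layout_write_queue (size qs) w (layout_write_todo 0 MM wn).
  apply: layout_ext MM1 _ _ _ _ => //= [i _|i]; last by rewrite nth_rcons_upd.
  rewrite updE mem_rcons in_cons; by case: eqP.
move=> H1; apply: (runs_to_bind H1); first by lia.
move=> [_ R2' M2] [/= -> R2t RR2 MM2] {H1}.
have F2 : same_except [:: rPtr; rLeft; rAddr; rHeadVertex; rTmp; rTail] R R2'.
  by apply: same_except_trans RR' RR2 _.
have Rb2 : bases R2' by apply: same_except_bases F2 Rb.
have [_ _ _ [_ R24 _]] := Rb2.
have R2w : R2' rHeadVertex = w by rewrite RR2 // /R' !updE.
have R2f : R2' rFlag = R rFlag by rewrite F2.
do 5 exec1; rewrite R24 R2w R2f (layout_cnt MM2) //.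
set R3' := upd _ _ _; set M3 := upd _ _ _.
have RR3 : same_except [:: rAddr; rTmp] R2' R3' by rewrite /R3'; frame.
have F3 : same_except [:: rPtr; rLeft; rAddr; rHeadVertex; rTmp; rTail] R R3'.
  by apply: same_except_trans F2 RR3 _.
have Rb3 : bases R3' by apply: same_except_bases F3 Rb.
have MM3 : queue_layout M3 (fun v => cnt v + R rFlag * (v == w)) qs'.
  apply: layout_ext (layout_write_cnt _ MM2 wn) _ _ _ _ => //= v vn.
  by rewrite updE; case: eqP => [->|_]; rewrite ?muln1 ?muln0 ?addn0.
apply: (runs_to_bind (IHl R3' M3 _ _ Rb3 MM3 _ _ ln' _)).
- by rewrite RR3 // RR2 // /R' !updE.
- by rewrite RR3 // RR2 // /R' !updE.
- by rewrite RR3 // R2t.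
- exact: leqnn.
move=> [_ R4' M4] [/= -> R4t RR4 MM4]; apply: runs_to_here; split=> //=.
  by apply: same_except_trans F3 RR4 _.
apply: layout_ext MM4 _ _ _ _ => //= v vn.
by rewrite F3 // eq_sym mulnDr addnA.
Qed.

(** For [prev] the number of active vertices on the previous level and [cnt u] the number of those
    with an arc to [u], a strict inequality means that one of them is not adjacent to [u]. *)
Definition active_vertex (prev : nat) (cnt : nat -> nat) u := (prev == 0) || (cnt u < prev).

(** [dn] has been served and [us] is the rest of the level. No arc joins two vertices of [us], so
    serving one leaves the counters of the others intact and all tests may refer to the initial
    [cnt]. *)
Lemma vertex_loop us dn R M cnt qs :
  bases R -> queue_layout M cnt qs -> prefix (dn ++ us) qs -> all (ltn^~ n) us ->
  (forall u v, u \in us -> v \in us -> v \notin a u) ->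
  R rHead = size dn -> R rEnd = size (dn ++ us) -> R rTail = size qs ->
  runs_to P (\sum_(u <- us) (17 * size (a u) + 17) + 2) (Config 33 R M) (fun c =>
    [/\ [/\ pc c = 66, reg c rHead = size (dn ++ us)
          & reg c rTail = size (enqueue qs (flatten [seq a u | u <- us]))],
        reg c rCur = R rCur + count (active_vertex (R rPrev) cnt) us,
        same_except [:: rVertex; rPtr; rLeft; rAddr; rHeadVertex; rTmp; rHead; rTail;
          rCur; rFlag] R (reg c) &
        queue_layout (memory c)
          (fun w => cnt w + \sum_(u <- us | active_vertex (R rPrev) cnt u) count_mem w (a u))
          (enqueue qs (flatten [seq a u | u <- us]))]).
Proof.
elim: us dn R M cnt qs => [|u us IHus] dn R M cnt qs Rb MM pre usn sep Rh Re Rt.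
  apply: (@runs_to_le _ _ _ 2); last exact: leq_addl.
  exec1; exec1; rewrite Rh Re cats0 subnn /=; apply: runs_to_here; split=> //=.
  - by rewrite addn0.
  - by frame.
  by apply: layout_ext MM _ _ _ _ => //= i _; rewrite big_nil addn0.
have [R0 R1 R2 [R3 R4 R5]] := Rb; have /andP[un usn'] := usn.
have qu : nth 0 qs (size dn) = u.
  by case/prefixP: pre => s ->; rewrite -catA nth_cat ltnn subnn.
have [offL offx seg] := segment_cons (segment_offset un).
rewrite big_cons; set B := \sum_(_ <- _) _.
(* Take a vertex off the queue, test whether it is active, find its list, traverse the list, then
   serve the remaining vertices. *)
apply: (@runs_to_le _ _ _ (6 + (6 + (4 + ((17 * size (a u)).+1 + (B + 2))))));
  last by lia.
exec1; exec1; have -> : R rEnd - R rHead == 0 = false.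
  by rewrite Rh Re size_cat /=; lia.
do 4 exec1; rewrite Rh R5 R1 (layout_queue MM) qu.
set R' := upd _ _ _.
have R'u : R' rVertex = u by rewrite /R' !updE.
pose b := active_vertex (R rPrev) cnt u.
have RR' : same_except [:: rVertex; rAddr; rTmp; rHead; rFlag] R R' by rewrite /R'; frame.
have H1 : runs_to P 6 (Config 39 R' M) (fun c =>
    [/\ pc c = 45, reg c rFlag = b, same_except [:: rAddr; rTmp; rFlag] R' (reg c)
      & memory c = M]).
  exec1; rewrite /b /active_vertex RR' //; case: eqP => [_|/eqP p0] /=.
    by exec1; apply: runs_to_here; split=> //=; frame.
  do 4 exec1; rewrite (RR' rPrev) // (RR' rCount) // R'u R4 (layout_cnt MM) // subn_eq0 leqNgt.
  case: ltnP => _ /=; last by apply: runs_to_here; split=> //=; frame.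
  by exec1; apply: runs_to_here; split=> //=; frame.
apply: (runs_to_bind H1) => [|[_ R2' M2] [/= -> R2f RR2 ->]] {H1}; first by lia.
have F2 : same_except [:: rVertex; rAddr; rTmp; rHead; rFlag] R R2'.
  by apply: same_except_trans RR' RR2 _.
have [R20 R21 _ _] : bases R2' by apply: same_except_bases F2 Rb.
have R2u : R2' rVertex = u by rewrite RR2 // /R' !updE.
do 4 exec1; rewrite R20 R2u R2f F2 // (layout_off MM) // (layout_input MM) // offx.
set R3' := upd _ _ _.
have RR3 : same_except [:: rPtr; rLeft; rAddr; rCur] R2' R3' by rewrite /R3'; frame.
have F3 : same_except [:: rVertex; rPtr; rLeft; rAddr; rTmp; rHead; rCur; rFlag] R R3'.
  by apply: same_except_trans F2 RR3 _.
have Rb3 : bases R3' by apply: same_except_bases F3 Rb.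
apply: (runs_to_bind (@arc_loop (a u) R3' M _ _ Rb3 MM _ _ (adj_ltn un) _)).
- by rewrite /R3' !updE.
- by rewrite /R3' !updE.
- by rewrite F3.
- exact: leq_addr.
move=> [_ R4' M4] [/= -> R4t RR4 MM4].
have F4 : same_except [:: rVertex; rPtr; rLeft; rAddr; rHeadVertex; rTmp; rHead; rTail;
    rCur; rFlag] R R4' by apply: same_except_trans F3 RR4 _.
have R4h : R4' rHead = size (rcons dn u).
  by rewrite RR4 // RR3 // RR2 // /R' !updE /= size_rcons addn1.
have R4c : R4' rCur = R rCur + b by rewrite RR4 // /R3' !updE.
have R3f : R3' rFlag = b by rewrite RR3.
rewrite R3f in MM4.
have actE : {in us, active_vertex (R rPrev) (fun w => cnt w + b * count_mem w (a u)) =1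
                    active_vertex (R rPrev) cnt}.
  move=> v vus; rewrite /active_vertex (count_memPn _) ?muln0 ?addn0 //.
  by apply: sep; rewrite ?mem_head ?in_cons ?vus ?orbT.
apply: (runs_to_bind (IHus (rcons dn u) R4' M4 _ _ _ MM4 _ usn' _ R4h _ R4t)).
- exact: same_except_bases F4 Rb.
- by rewrite cat_rcons; apply: prefix_trans pre (prefix_enqueue _ _).
- by move=> v w vus wus; apply: sep; rewrite in_cons ?vus ?wus orbT.
- by rewrite F4 // cat_rcons.
- by rewrite /B; lia.
move=> [_ R6' M6] [/= [-> R6h R6t] R6c RR6 MM6]; apply: runs_to_here.
rewrite enqueue_cat; split=> //=.
- by rewrite R6h cat_rcons.
- by rewrite R6c R4c F4 // -addnA (eq_in_count actE).
- by apply: same_except_trans F4 RR6 _.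
apply: layout_ext MM6 _ _ _ _ => //= w wn.
rewrite F4 // -addnA big_cons -/b; congr (_ + _).
rewrite big_seq_cond [in RHS]big_seq_cond.
rewrite (eq_bigl (fun v => (v \in us) && active_vertex (R rPrev) cnt v)); last first.
  by move=> v; case: (boolP (v \in us)) => //= /actE.
by case: (b); rewrite ?mul1n ?mul0n.
Qed.

End Adjacency.
End Simulation.

Lemma drop_flatten (ss : seq (seq nat)) t u : u <= size ss ->
  drop (\sum_(v < u) size (nth [::] ss v)) (flatten ss ++ t) = flatten (drop u ss) ++ t.
Proof.
elim: u ss => [|u IHu] [|l ss] //=; rewrite ?big_ord0 ?drop0 // ltnS => us.
by rewrite big_ord_recl /= addnC -drop_drop -catA drop_size_cat // IHu.
Qed.

(** * The breadth-first search on a layered digraph *)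

Section LayeredRun.
Variables (n : nat) (e : rel 'I_n) (adj : 'I_n -> seq 'I_n) (tail : seq nat).
Hypothesis adj_uniq : forall u, uniq (adj u).
Hypothesis mem_adj : forall u v, (v \in adj u) = e u v.
Variables (lev : 'I_n -> nat) (s : 'I_n).
Hypothesis lev_arc : forall u v, e u v -> lev v = (lev u).+1.
Hypothesis lev_eq0 : forall v, (lev v == 0) = (v == s).
Hypothesis in_neighbour : forall v, 0 < lev v -> exists u, e u v.
Variable post : program.

Let x := adjacency_words adj ++ tail.
Let a u := nth [::] [seq map val (adj v) | v <- enum 'I_n] u.
Let P := layers_program ++ post.

Lemma adjE (v : 'I_n) : a v = map val (adj v).
Proof. by rewrite /a (nth_map v) ?nth_ord_enum // size_enum_ord. Qed.

Lemma mem_a (u v : 'I_n) : (val v \in a u) = e u v.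
Proof. by rewrite adjE (mem_map val_inj) mem_adj. Qed.

Lemma a_ltn u : u < n -> all (ltn^~ n) (a u).
Proof.
move=> un; rewrite (adjE (Ordinal un)); apply/allP=> _ /mapP[v _ ->] /=.
exact: ltn_ord.
Qed.

Lemma segment_a u : u < n -> segment x (size (a u) :: a u) (offset a u).
Proof.
move=> un; rewrite /segment /offset /x /adjacency_words cat_cons add1n /=.
set ss := [seq _ | _ <- _].
have sss : size ss = n by rewrite size_map size_enum_ord.
have ssE v : v < n -> nth [::] ss v = size (a v) :: a v.
  move=> vn; rewrite /ss (nth_map (Ordinal vn)) ?size_enum_ord //.
  by rewrite (nth_ord_enum (Ordinal vn) (Ordinal vn)) (adjE (Ordinal vn)) size_map.
rewrite (eq_bigr (fun v : 'I_u => size (nth [::] ss v))) => [|v _]; last first.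
  by rewrite ssE // (ltn_trans _ un).
rewrite drop_flatten ?sss ?(ltnW un) // (drop_nth [::]) ?sss // ssE //=.
by rewrite eqxx -catA; apply: prefix_prefix.
Qed.

Lemma size_input : size x = 1 + \sum_(v : 'I_n) (size (adj v)).+1 + size tail.
Proof.
rewrite size_cat /= size_flatten /shape -map_comp sumnE big_map big_enum /=.
by congr (_.+1 + _); apply: eq_bigr => v _; rewrite size_map.
Qed.

Section Level.
Variables (i : nat) (us : seq nat) (cnt : nat -> nat).
Hypothesis us_uniq : uniq us.
Hypothesis us_ltn : all (ltn^~ n) us.
Hypothesis mem_us : forall v : 'I_n, (val v \in us) = (lev v == i).
Hypothesis cntE : forall v, lev v = i -> cnt (val v) = #|[set u in active e lev i | e u v]|.

Lemma perm_level : perm_eq us [seq val v | v <- enum [set v | lev v == i]].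
Proof.
apply: uniq_perm => // [|w]; first by rewrite (map_inj_uniq val_inj) enum_uniq.
have [wn|nw] := ltnP w n.
  by rewrite -[w]/(val (Ordinal wn)) (mem_map val_inj) mem_enum inE mem_us.
apply/idP/mapP => [/(allP us_ltn)|[v _ wv]]; first by rewrite /= ltnNge nw.
by have := ltn_ord v; rewrite -wv ltnNge nw.
Qed.

(** The in-neighbours counted form a subset of [active e lev i]; their number falls short of its
    cardinality exactly when the subset is proper. *)
Lemma active_vertexE v : lev v = i ->
  active_vertex #|active e lev i| cnt (val v) = (v \in active e lev i.+1).
Proof.
move=> lv; rewrite in_active lv eqxx /active_vertex cards_eq0 cntE //=; congr orb.
have sub : [set u in active e lev i | e u v] \subset active e lev i.
  by apply/subsetP=> u; rewrite inE => /andP[].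
rewrite ltn_neqAle subset_leq_card // andbT (subset_leqif_cards sub).
apply/idP/exists_inP => [|[u uA uv]]; last first.
  by apply: contra uv => /eqP E; move: uA; rewrite -E inE => /andP[].
move=> neq; apply/exists_inP; apply: contraR neq => /exists_inP no; apply/eqP/setP=> u; rewrite inE.
by case: (boolP (u \in _)) => //= uA; apply/negPn/negP=> uv; apply: no; exists u.
Qed.

Lemma sum_level (F : nat -> nat) :
  \sum_(u <- us) F u = \sum_(v | lev v == i) F (val v).
Proof.
rewrite (perm_big _ perm_level) big_map big_enum /=.
by apply: eq_bigl => v; rewrite inE.
Qed.

Lemma sum_active (F : nat -> nat) :
  \sum_(u <- us | active_vertex #|active e lev i| cnt u) F u =
  \sum_(v in active e lev i.+1) F (val v).
Proof.
rewrite big_mkcond sum_level big_mkcond [in RHS]big_mkcond /=.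
apply: eq_bigr => v _; case: eqP => [lv|lv]; first by rewrite active_vertexE.
by case: ifP => // /active_lev.
Qed.

Lemma count_active :
  count (active_vertex #|active e lev i| cnt) us = #|active e lev i.+1|.
Proof. by rewrite -sum1_count (sum_active (fun=> 1)) sum1_card. Qed.

(** The increments made while serving level [i] are the counters that level [i.+1] is tested
    with. *)
Lemma count_mem_level (w : 'I_n) :
  \sum_(u <- us | active_vertex #|active e lev i| cnt u) count_mem (val w) (a u) =
  #|[set u in active e lev i.+1 | e u w]|.
Proof.
rewrite (sum_active (fun u => count_mem (val w) (a u))) -sum1_card.
rewrite [LHS]big_mkcond [RHS]big_mkcond; apply: eq_bigr => v _; rewrite inE.
case: (boolP (v \in _)) => //= _; rewrite count_uniq_mem ?mem_a; first by case: (e v w).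
by rewrite adjE (map_inj_uniq val_inj).
Qed.

End Level.

Let L := size x.

(** Arcs from level [i] end on level [i.+1], not yet in the queue, and each vertex there has an
    in-neighbour, necessarily on level [i]. *)
Lemma next_level i dn us :
  uniq (dn ++ us) -> all (ltn^~ n) (dn ++ us) ->
  (forall v : 'I_n, (val v \in dn) = (lev v < i)) ->
  (forall v : 'I_n, (val v \in us) = (lev v == i)) ->
  exists us', [/\ enqueue (dn ++ us) (flatten [seq a u | u <- us]) = (dn ++ us) ++ us',
    uniq ((dn ++ us) ++ us'), all (ltn^~ n) ((dn ++ us) ++ us'),
    forall v : 'I_n, (val v \in dn ++ us) = (lev v < i.+1) &
    forall v : 'I_n, (val v \in us') = (lev v == i.+1)].
Proof.
move=> uq qn mem_dn mem_us.
have [us' E] := prefixP (prefix_enqueue (dn ++ us) (flatten [seq a u | u <- us])).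
have uq' := enqueue_uniq (flatten [seq a u | u <- us]) uq.
have memq (v : 'I_n) : (val v \in dn ++ us) = (lev v < i.+1).
  by rewrite mem_cat mem_dn mem_us ltnS [RHS]leq_eqVlt orbC.
exists us'; rewrite -E; split=> // [|v].
  apply/allP=> w; rewrite mem_enqueue => /orP[|/flattenP[_ /mapP[u uus ->]]].
    exact: (allP qn).
  have un : u < n by apply: (allP qn); rewrite mem_cat uus orbT.
  exact: (allP (a_ltn un)).
have -> : (val v \in us') = (val v \notin dn ++ us) &&
    (val v \in enqueue (dn ++ us) (flatten [seq a u | u <- us])).
  move: uq'; rewrite E cat_uniq => /and3P[_ /hasPn dis _].
  have -> : (val v \in (dn ++ us) ++ us') = (val v \in dn ++ us) || (val v \in us').
    by rewrite mem_cat.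
  by case: (boolP (val v \in us')) => [/dis/negbTE/= ->|_]; rewrite ?orbF ?andNb.
rewrite mem_enqueue memq -leqNgt; apply/andP/eqP => [[iv]|lv].
  rewrite ltnNge iv /= => /flattenP[_ /mapP[u uus ->]].
  have un : u < n by apply: (allP qn); rewrite mem_cat uus orbT.
  rewrite -[u]/(val (Ordinal un)) in uus *.
  by rewrite mem_a => /lev_arc ->; move: uus; rewrite mem_us => /eqP ->.
split; first by rewrite lv.
have [|u uv] := @in_neighbour v; first by rewrite lv.
apply/orP; right; apply/flattenP; exists (a u); last by rewrite mem_a.
apply: map_f; rewrite mem_us; move: (lev_arc uv); rewrite lv => -[->]; exact: eqxx.
Qed.

(** The input cells must survive because the decision code reads the bound in the last of them. *)
Definition finished (c : config) :=
  [/\ pc c = 70, bases x n (reg c),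
      exists2 j, (forall v, lev v < j) & reg c rAns = active_levels e lev j
    & forall l, l < L -> memory c l = nth 0 x l].

Lemma layer_loop_exit i R M off todo cnt q :
  bases x n R -> layout x n M off todo cnt q -> (forall v, lev v != i) ->
  R rHead = R rTail -> R rAns = active_levels e lev i ->
  runs_to P 2 (Config 29 R M) finished.
Proof.
move=> Rb MM noi Rh Ra; exec1; exec1; rewrite Rh subnn /=.
apply: runs_to_here; split=> //=; last by case: MM.
exists i => // v; rewrite ltnNge; apply/negP=> iv.
have [w wi] := level_inhabited lev_arc in_neighbour iv (ex_intro _ v erefl).
by move: (noi w); rewrite wi eqxx.
Qed.

(** On entry at 29, [dn] holds the levels below [i] and [us] is level [i]; the counters are right on
    level [i] and still 0 above. [k] bounds the remaining levels and drives the induction. *)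
Lemma layer_loop k i dn us R M cnt :
  (forall v, lev v < i + k) ->
  bases x n R -> queue_layout x n a M cnt (dn ++ us) ->
  uniq (dn ++ us) -> all (ltn^~ n) (dn ++ us) ->
  (forall v : 'I_n, (val v \in dn) = (lev v < i)) ->
  (forall v : 'I_n, (val v \in us) = (lev v == i)) ->
  (forall v, lev v = i -> cnt (val v) = #|[set u in active e lev i | e u v]|) ->
  (forall v, i < lev v -> cnt (val v) = 0) ->
  R rHead = size dn -> R rTail = size (dn ++ us) ->
  R rPrev = #|active e lev i| -> R rAns = active_levels e lev i ->
  runs_to P (\sum_(v | i <= lev v) (17 * size (adj v) + 27) + 2) (Config 29 R M)
    finished.
Proof.
elim: k i dn us R M cnt => [|k IHk] i dn us R M cnt levk Rb MM uq qn mem_dn mem_us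
  cntE cnt0 Rh Rt Rp Ra; have [R0 R1 R2 [R3 R4 R5]] := Rb.
  apply: (@runs_to_le _ _ _ 2); last exact: leq_addl.
  have noi v : lev v != i by move: (levk v); rewrite addn0; case: ltngtP.
  apply: (layer_loop_exit Rb MM noi _ Ra); rewrite Rh Rt.
  suff -> : us = [::] by rewrite cats0.
  case: us qn mem_us {uq MM Rt} => // u us qn mem_us.
  have un : u < n by apply: (allP qn); rewrite mem_cat mem_head orbT.
  by have := mem_us (Ordinal un); rewrite mem_head (negbTE (noi _)).
have [us0|usN0] := eqVneq us [::].
  apply: (@runs_to_le _ _ _ 2); last exact: leq_addl.
  apply: (layer_loop_exit Rb MM _ _ Ra) => [v|]; first by rewrite -mem_us us0.
  by rewrite Rh Rt us0 cats0.
have usn : all (ltn^~ n) us by move: qn; rewrite all_cat => /andP[].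
have us_uniq : uniq us by move: uq; rewrite cat_uniq => /and3P[].
have sep u v : u \in us -> v \in us -> v \notin a u.
  move=> uus vus; have un := allP usn u uus; have vn := allP usn v vus.
  rewrite -[u]/(val (Ordinal un)) -[v]/(val (Ordinal vn)) in uus vus *.
  rewrite mem_a; apply/negP=> /lev_arc.
  by move: uus vus; rewrite !mem_us => /eqP -> /eqP ->; lia.
have [us' [quE uq' qn' mem_q mem_us']] := next_level uq qn mem_dn mem_us.
have splitE : \sum_(v | i <= lev v) (17 * size (adj v) + 27) =
    \sum_(u <- us) (17 * size (a u) + 27) +
    \sum_(v | i < lev v) (17 * size (adj v) + 27).
  rewrite (sum_level us_uniq usn mem_us) (bigID (fun v => lev v == i)) /=.
  congr (_ + _); last by apply: eq_bigl => v; case: ltngtP.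
  apply: eq_big => [v|v _]; first by case: ltngtP.
  by rewrite adjE size_map.
(* The overhead of a level, [4 + 2 + 4] steps, is charged to one of its vertices; [us] is
   nonempty. *)
have us_cost : \sum_(u <- us) (17 * size (a u) + 17) + 10 <=
    \sum_(u <- us) (17 * size (a u) + 27).
  rewrite [X in _ <= X](eq_bigr (fun u => 17 * size (a u) + 17 + 10)); last first.
    by move=> u _; rewrite -addnA.
  rewrite [X in _ <= X]big_split leq_add2l /= big_const_seq count_predT iter_addn_0.
  by case: (us) usN0 => //= u l _; rewrite leq_pmulr.
rewrite splitE; set A := \sum_(u <- us) _ in us_cost *; set B := \sum_(v | _) _.
set C := \sum_(u <- us) _ in us_cost *.
apply: (@runs_to_le _ _ _ (4 + ((A + 2) + (4 + (B + 2))))); last by lia.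
exec1; exec1; have -> : R rTail - R rHead == 0 = false.
  by rewrite Rt Rh size_cat; case: (us) usN0 => //= u l _; lia.
exec1; exec1.
set R' := upd _ _ _.
have RR' : same_except [:: rTmp; rEnd; rCur] R R' by rewrite /R'; frame.
have Rb' : bases x n R' by apply: same_except_bases RR' Rb.
apply: (runs_to_bind (@vertex_loop x n post a segment_a a_ltn us dn R' M cnt _
  Rb' MM (prefix_refl _) usn sep _ _ _)).
- by rewrite RR'.
- by rewrite /R' !updE.
- by rewrite RR'.
- exact: leq_addr.
move=> [_ R2' M2] [/= [-> R2h R2t] R2c RR2 MM2]; rewrite addKn.
rewrite quE in R2t MM2; rewrite (RR' rPrev) // Rp in R2c MM2.
have R'c : R' rCur = 0 by rewrite /R' !updE.
rewrite (count_active us_uniq usn mem_us cntE) R'c add0n in R2c.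
have F2 : same_except [:: rVertex; rPtr; rLeft; rAddr; rHeadVertex; rTmp; rHead; rTail;
    rEnd; rCur; rFlag] R R2' by apply: same_except_trans RR' RR2 _.
have Rb2 : bases x n R2' by apply: same_except_bases F2 Rb.
have [_ R21 _ _] := Rb2.
have H1 : runs_to P 4 (Config 66 R2' M2) (fun c =>
    [/\ pc c = 29, reg c rPrev = #|active e lev i.+1|,
        reg c rAns = active_levels e lev i.+1,
        same_except [:: rPrev; rAns] R2' (reg c) & memory c = M2]).
  exec1; exec1; rewrite R2c cards_eq0 active_levelsS; case: eqP => [A0|_] /=.
    by apply: runs_to_here; split=> //=; [rewrite !updE /= F2 // Ra addn0 | frame].
  exec1; exec1; rewrite R21 F2 // Ra.
  by apply: runs_to_here; split=> //=; frame.
apply: (runs_to_bind H1) => [|[_ R3' M3] [/= -> R3p R3a RR3 ->]] {H1}; first exact: leq_addr.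
rewrite addKn.
apply: (runs_to_bind (IHk i.+1 (dn ++ us) us' R3' M2 _ _ _ MM2 uq' qn' mem_q
  mem_us' _ _ _ _ R3p R3a)) => //.
- by move=> v; rewrite addSnnS.
- exact: same_except_bases RR3 Rb2.
- move=> v lv; rewrite cnt0 ?lv // add0n.
  exact: count_mem_level us_uniq usn mem_us cntE v.
- move=> v lv; rewrite cnt0 ?(ltnW lv) // add0n.
  rewrite (count_mem_level us_uniq usn mem_us cntE).
  apply: eq_card0 => u; rewrite inE; apply/andP=> -[/active_lev lu /lev_arc].
  by move: lv; rewrite lu; lia.
- by rewrite RR3.
- by rewrite RR3.
- by move=> c fc; apply: runs_to_here.
Qed.

Lemma layout_init : layout x n (nth 0 x) (fun=> 0) (fun=> 0) (fun=> 0) (fun=> 0).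
Proof. by split=> // i *; rewrite nth_default // -?addnA leq_addr. Qed.

Lemma layers_program_run :
  runs_to P (64 * L) (init x) finished.
Proof.
pose D := \sum_(v : 'I_n) size (adj v).
have LD : L = 1 + (D + n) + size tail.
  rewrite /L size_input (eq_bigr (fun v => size (adj v) + 1)) => [|v _]; last first.
    by rewrite addn1.
  by rewrite big_split /= sum1_card card_ord.
have scanD : \sum_(0 <= v < n) (7 * size (a v) + 9) = 7 * D + 9 * n.
  rewrite big_mkord (eq_bigr (fun v => 7 * size (adj v) + 9)) => [|v _]; last first.
    by rewrite adjE size_map.
  by rewrite big_split /= -big_distrr sum_nat_const card_ord mulnC.
have layersD : \sum_(v | 0 <= lev v) (17 * size (adj v) + 27) = 17 * D + 27 * n.
  rewrite big_split /= -big_distrr /= sum_nat_const card_ord [n * _]mulnC.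
  by [].
have sn : val s < n := ltn_ord s.
pose T1 := 7 * D + 9 * n + 2; pose T2 := 5 * n + 3; pose T3 := 17 * D + 27 * n + 2.
(* Set-up, scan of the lists, search for the source and layer loop take at most
   [24 * D + 41 * n + 16] steps in all. *)
apply: (@runs_to_le _ _ _ (6 + (T1 + (1 + (T2 + (2 + T3)))))); last first.
  by rewrite /T1 /T2 /T3; lia.
rewrite /init; do 6 exec1; rewrite -/L.
set R := upd _ _ _.
have Rb : bases x n R by [].
have R0 r : r \notin [:: rBase; rOne; rOrder; rTodo; rCount; rQueue; rPtr] -> R r = 0.
  by rewrite !inE /R !updE; do 7 case: eqP => //.
have Rp : R rPtr = offset a (R rVertex) by rewrite /offset (R0 rVertex) // big_ord0.
apply: (runs_to_bind (@scan_loop x n post a segment_a a_ltn n R _ _ _ _ Rb _ Rp _ _)).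
- by rewrite (R0 rVertex).
- rewrite (R0 rVertex) //; exact: layout_init.
- by rewrite (R0 rVertex).
- by rewrite (R0 rVertex) // scanD leq_addr.
rewrite {1}(R0 rVertex) // scanD -/T1 addKn; move=> [_ R1 M1] [/= -> RR1 MM1].
have Rb1 : bases x n R1 by apply: same_except_bases RR1 Rb.
exec1; set R2 := upd _ _ _.
have RR2 : same_except [:: rVertex] R1 R2 by rewrite /R2; frame.
have Rb2 : bases x n R2 by apply: same_except_bases RR2 Rb1.
have headE (w : 'I_n) : is_head a n w = (w != s).
  rewrite -lev_eq0 -lt0n; apply/hasP/idP => [[u]|/in_neighbour[u uw]].
    rewrite mem_iota => /andP[_ un]; rewrite -[u]/(val (Ordinal un)) mem_a.
    by move=> /lev_arc ->.
  by exists (val u); rewrite ?mem_a // mem_iota ltn_ord.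
have sT2 : 5 * s + 3 <= T2 by rewrite /T2 leq_add2r leq_mul2l ltnW.
apply: (runs_to_bind (@source_loop x n post s s R2 M1 _ _ _ _ Rb2 MM1 _ sn _ _)).
- by rewrite /R2 !updE.
- by rewrite headE eqxx.
- move=> w ws; rewrite -[w]/(val (Ordinal (ltn_trans ws sn))) headE eqb0 negbK.
  by apply/eqP=> /(congr1 val) /= wE; have := ws; rewrite {1}wE ltnn.
- exact: leq_trans sT2 (leq_addr _ _).
move=> [_ R3 M3] [/= -> R3v RR3 ->].
apply: (@runs_to_le _ _ _ (2 + T3)); last by rewrite -addnBAC // leq_addl.
have Rb3 : bases x n R3 by apply: same_except_bases RR3 Rb2.
have [_ R31 _ [_ _ R35]] := Rb3.
exec1; exec1; rewrite R35 R31 R3v; set R4 := upd _ _ _.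
have RR4 : same_except [:: rTail] R3 R4 by rewrite /R4; frame.
have R4z r : r \in [:: rHead; rPrev; rAns] -> R4 r = 0.
  by rewrite !inE => /or3P[] /eqP ->; rewrite RR4 ?RR3 ?RR2 ?RR1 ?R0.
rewrite /T3 -layersD.
apply: (@layer_loop (\max_v lev v).+1 0 [::] [:: val s] R4 _ (fun=> 0)).
- by move=> v; rewrite add0n ltnS leq_bigmax.
- exact: same_except_bases RR4 Rb3.
- have MM3 := layout_write_queue 0 s MM1.
  rewrite addn0 in MM3; apply: layout_ext MM3 _ _ _ _ => //= [w wn|[|[|w]]] //.
  by rewrite -[w]/(val (Ordinal wn)) headE inE.
- by [].
- by rewrite /= sn.
- by [].
- by move=> v; rewrite inE lev_eq0.
- by move=> v _; rewrite eq_card0 // => u; rewrite !inE.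
- by [].
- by rewrite R4z.
- by rewrite /R4 !updE.
- by rewrite R4z // cards0.
- by rewrite R4z // /active_levels big_ord0.
Qed.

End LayeredRun.

(** * Levels from a layering *)

Section Layering.
Variables (T : finType) (e : rel T).

(** The level is the index of the layer, unique by disjointness. The first layer is the only source,
    so every other vertex has an in-neighbour. *)
Lemma layered_levels : single_sourced_layered_dag e ->
  exists (lev : T -> nat) (s : T),
    [/\ forall u v, e u v -> lev v = (lev u).+1,
        forall v, (lev v == 0) = (v == s) &
        forall v, 0 < lev v -> exists u, e u v].
Proof.
case=> _ _ [t [V layV]] s1; have [V0 _] := single_source_layer0 layV s1.
have [[_ disV covV] _ _ arcV] := layV.
have [s sE] : exists s, sources e = [set s] by apply/cards1P/eqP.
have ex v : exists i, v \in V i.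
  by have : v \in [set: T] := in_setT v; rewrite -covV => /bigcupP[i _ vi]; exists i.
pose lev v : 'I_t.+1 := xchoose (ex v).
have levV v : v \in V (lev v) := xchooseP (ex v).
have levE v i : v \in V i -> lev v = i.
  move=> vi; apply/eqP; apply/negPn/negP=> /disV dis.
  by have := disjointFr dis (levV v); rewrite vi.
have lev0 v : (nat_of_ord (lev v) == 0) = (v == s).
  have -> : (v == s) = (v \in V ord0) by rewrite V0 sE inE.
  apply/eqP/idP => [l0|/levE -> //].
  by have := levV v; congr (v \in V _); apply: val_inj.
exists (fun v => lev v), s; split=> // [u v uv|v].
  by have [i [j [/levE -> /levE -> ->]]] := arcV u v uv.
rewrite lt0n lev0 => vs; apply/existsP; apply: contraR vs => /existsPn nov.
by rewrite -in_set1 -sE inE; apply/forallP.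
Qed.

End Layering.

Lemma input_run (D : digraph) (x tail : seq nat) (post : program) :
  single_sourced_layered_dag (@dg_arc D) -> encodes D x ->
  runs_to (layers_program ++ post) (64 * size (x ++ tail)) (init (x ++ tail)) (fun c =>
    [/\ pc c = 70, reg c rBase = size (x ++ tail), reg c rOne = 1,
        max_multipacking_size (@dg_arc D) (reg c rAns)
      & forall i, i < size (x ++ tail) -> memory c i = nth 0 (x ++ tail) i]).
Proof.
move=> /layered_levels[lev [s [arcL lev0 inL]]] [adj [uadj adjE ->]].
have := layers_program_run tail uadj adjE arcL lev0 inL post.
case=> k kt [pck [R0 R1 _ _] [j levj ans] mem]; exists k => //; split=> //.
by rewrite ans; exact: (max_multipacking_active_levels arcL lev0 inL levj).
Qed.

Theorem theorem19 :
  solvable_in_linear_time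
    (fun D : digraph => single_sourced_layered_dag (@dg_arc D))
    encodes
    (fun D s => max_multipacking_size (@dg_arc D) s)
  /\
  solvable_in_linear_time
    (fun Dk : digraph * nat => single_sourced_layered_dag (@dg_arc Dk.1))
    encodes_with_bound
    (fun Dk b => multipacking_decision (@dg_arc Dk.1) Dk.2 b).
Proof.
have flag0 r : flag_register r -> r != 0 by case: r.
split.
  (* [67 = 64 + 1 + 2]: the search, the final copy, and the 2 that [computes_of_run] adds; 4 is the
     highest register level. *)
  exists size_program, (2 ^ 4 * 67) => D x layD encx.
  apply: (computes_of_run flag0 register_level_le4 size_program_leveled).
    by rewrite (size_encodes encx).
  have := input_run [::] [:: Copy rBase rAns] layD encx; rewrite cats0 => run.
  apply: (@runs_to_le _ _ _ (64 * size x + 1)); last first.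
    by rewrite (size_encodes encx); lia.
  apply: runs_to_bind_le run _ => -[_ R M] [/= -> _ _ maxR _].
  by exec1; apply: runs_to_here.
(* [72 = 64 + 6 + 2], as the decision code takes at most six steps. *)
exists decision_program, (2 ^ 4 * 72) => -[D k] _ layD [x encx ->].
apply: (computes_of_run flag0 register_level_le4 decision_program_leveled).
  by rewrite size_rcons.
rewrite -cats1; have run := input_run [:: k] decision_code layD encx.
apply: (@runs_to_le _ _ _ (64 * size (x ++ [:: k]) + 6)); last first.
  by rewrite size_cat addn1; lia.
apply: runs_to_bind_le run _ => -[_ R M] [/= -> R0 R1 [[S [Smp cS]] maxS] mem].
rewrite size_cat addn1 in R0 mem.
have Mk : M (size x) = k by rewrite mem // nth_cat ltnn subnn.
do 4 exec1; rewrite R0 R1 subn1 /= Mk; exec1.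
(* The truncated difference of [k] and the maximum is 0 exactly when [k] is at most the maximum. *)
case: eqP => [/eqP kle|/eqP kgt].
  apply: runs_to_here; split=> //=; rewrite !updE /=; left; split=> //.
  by exists S; split=> //; rewrite cS -subn_eq0.
exec1; apply: runs_to_here; split=> //=; rewrite !updE /=; right; split=> //.
by case=> S' [/maxS S'le kS']; move: kgt; rewrite subn_eq0 (leq_trans kS').
Qed.
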